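(* For every integer $t\geq 1$, every graph $G$ that does not contain $K^*_{2,t}$ as a minor satisfies, for every integer $r\geq 1$, \[\mathrm{scol}_r(G)\leq 2(t-1)(2r+1)\quad\text{and}\quad \mathrm{wcol}_r(G)\leq (t-1)(r+1)(2r+1).\]
   Context: All graphs are finite and simple. $K^*_{2,t}$ is the complete join of $K_2$ and $\overline{K_t}$. For a graph $G$, a linear ordering $\preceq$ of $V(G)$, a vertex $v$ and an integer $r\geq 1$: $S_r(G,\preceq,v)$ is the set of vertices $x$ for which there is a path $v=w_0,w_1,\dots,w_{r'}=x$ with $0\le r'\le r$, $x\preceq v$ and $v\prec w_i$ for all $1\le i\le r'-1$; $W_r(G,\preceq,v)$ is the set of vertices $x$ for which there is such a path with $x\preceq v$ and $x\prec w_i$ for all $1\le i\le r'-1$. The $r$-strong colouring number $\mathrm{scol}_r(G)$ is the minimum $k$ such that some linear ordering $\preceq$ satisfies $|S_r(G,\preceq,v)|\le k$ for all $v$; the $r$-weak colouring number $\mathrm{wcol}_r(G)$ is the minimum $k$ such that some linear ordering satisfies $|W_r(G,\preceq,v)|\le k$ for all $v$.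
   Formalization: The formal theorem assumes t ≥ 2 rather than t ≥ 1; for t = 1 both bounds are 0, and the claim fails already for the one-vertex graph, which has no K_3 minor but has both colouring numbers equal to 1. *)

(* Defs.v *)
From mathcomp Require Import all_boot.

Set Implicit Arguments.
Unset Strict Implicit.
Unset Printing Implicit Defensive.

Structure sgraph := SGraph {
  vertex :> finType;
  adj : rel vertex;
  adj_sym : symmetric adj;
  adj_irrefl : irreflexive adj }.

Lemma complete_sym n : symmetric (fun x y : 'I_n => x != y).
Proof. by move=> x y; rewrite eq_sym. Qed.

Lemma complete_irrefl n : irreflexive (fun x y : 'I_n => x != y).
Proof. by move=> x; rewrite eqxx. Qed.

Definition complete n : sgraph := SGraph (@complete_sym n) (@complete_irrefl n).

Definition edgeless n : sgraph :=
  @SGraph 'I_n (fun _ _ => false) (fun _ _ => erefl) (fun _ => erefl).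

Definition join_adj (G H : sgraph) : rel (G + H)%type := fun a b =>
  match a, b with
  | inl x, inl y => adj x y
  | inr x, inr y => adj x y
  | _, _ => true
  end.

Lemma join_sym G H : symmetric (@join_adj G H).
Proof. by move=> [x|x] [y|y] //=; apply: adj_sym. Qed.

Lemma join_irrefl G H : irreflexive (@join_adj G H).
Proof. by move=> [x|x] /=; apply: adj_irrefl. Qed.

Definition join (G H : sgraph) : sgraph :=
  SGraph (@join_sym G H) (@join_irrefl G H).

Definition Kstar s t : sgraph := join (complete s) (edgeless t).

Definition connected_in (G : sgraph) (A : {set G}) : Prop :=
  {in A &, forall x y,
     connect (fun u w => [&& u \in A, w \in A & adj u w]) x y}.

(* [B] is the family of branch sets of a model of [H] in [G]. *)
Definition minor (H G : sgraph) : Prop :=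
  exists B : H -> {set G},
    [/\ forall h, B h != set0,
        forall h, connected_in (B h),
        forall h h', h != h' -> [disjoint B h & B h']
      & forall h h', adj h h' ->
          exists x y, [/\ x \in B h, y \in B h' & adj x y]].

Section Orders.
Variable T : finType.
Implicit Types (le : rel T) (O : {set T * T}).

(* Reflexivity is the diagonal case of totality. *)
Definition linear_order le : bool :=
  [&& [forall x, forall y, le x y && le y x ==> (x == y)],
      [forall y, forall x, forall z, le x y && le y z ==> le x z]
    & [forall x, forall y, le x y || le y x]].

Lemma linear_orderP le :
  reflect [/\ antisymmetric le, transitive le & total le] (linear_order le).
Proof.
apply: (iffP and3P) => -[H1 H2 H3]; split.
- by move=> x y xy; move/forallP/(_ x)/forallP/(_ y)/implyP/(_ xy)/eqP: H1.
- move=> y x z xy yz; move/forallP/(_ y)/forallP/(_ x)/forallP/(_ z): H2.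
  by rewrite xy yz.
- by move=> x y; move/forallP/(_ x)/forallP/(_ y): H3.
- by do 2![apply/forallP => ?]; apply/implyP => /H1 ->.
- by do 3![apply/forallP => ?]; apply/implyP => /andP[]; apply: H2.
- by do 2![apply/forallP => ?]; apply: H3.
Qed.

Definition strict le : rel T := fun x y => (x != y) && le x y.

(* A relation on [T] as a set of pairs, so that orderings form a [finType]. *)
Definition rel_of O : rel T := fun x y => (x, y) \in O.

Lemma linear_order_exists : exists O, linear_order (rel_of O).
Proof.
exists [set u | enum_rank u.1 <= enum_rank u.2].
apply/linear_orderP; split=> [x y|y x z|x y]; rewrite /rel_of !inE /=.
- by move=> le_xy; apply/enum_rank_inj/val_inj/anti_leq.
- exact: leq_trans.
- exact: leq_total.
Qed.

End Orders.

Section ColouringNumbers.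
Variable G : sgraph.
Implicit Types (le : rel G) (v x : G) (r k : nat).

(* [w_1, ..., w_(r'-1)] for the walk [w_0 :: p = w_0, w_1, ..., w_r']; empty
   when [r' <= 1]. *)
Definition inner (w0 : G) (p : seq G) : seq G := behead (belast w0 p).

(* The path [v = w_0, ..., w_r' = x] is [v :: p], with [r' = size p <= r]. *)
Definition strong_reach r le v : {set G} :=
  [set x | le x v &&
    [exists p : r.-bseq G,
       [&& path (@adj G) v p, uniq (v :: p), last v p == x
         & all (strict le v) (inner v p)]]].

Definition weak_reach r le v : {set G} :=
  [set x | le x v &&
    [exists p : r.-bseq G,
       [&& path (@adj G) v p, uniq (v :: p), last v p == x
         & all (strict le x) (inner v p)]]].

Definition scol_at_most r k : bool :=
  [exists O : {set G * G}, linear_order (rel_of O) &&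
     [forall v, #|strong_reach r (rel_of O) v| <= k]].

Definition wcol_at_most r k : bool :=
  [exists O : {set G * G}, linear_order (rel_of O) &&
     [forall v, #|weak_reach r (rel_of O) v| <= k]].

Lemma scol_bounded r : exists k, scol_at_most r k.
Proof.
have [O linO] := linear_order_exists G; exists #|G|; apply/existsP; exists O.
by rewrite linO; apply/forallP => v; apply: max_card.
Qed.

Lemma wcol_bounded r : exists k, wcol_at_most r k.
Proof.
have [O linO] := linear_order_exists G; exists #|G|; apply/existsP; exists O.
by rewrite linO; apply/forallP => v; apply: max_card.
Qed.

Definition scol r : nat := ex_minn (scol_bounded r).
Definition wcol r : nat := ex_minn (wcol_bounded r).

End ColouringNumbers.

(* Main.v *)
(* Peel off connected sets. Suppose a component C of what remains is attached
   to the removed vertices only through one connected set Q. In C take a BFS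
   tree rooted at a neighbour of Q and let H be the union of the tree paths from
   the root to all neighbours of Q in C. If H had t leaves other than the root,
   then Q, the rest of H and these leaves would be a model of K*_{2,t}; so H is
   a union of at most t-1 geodesics of C, and each of them has at most 2r+1
   vertices within distance r of a given vertex. The components of C - H are
   attached to H only.

   Let the depth of a vertex be the round in which it is removed. Adjacent
   vertices differ in depth by at most 1, and a vertex reaches at most
   (t-1)(2r+1) vertices of depth n by paths of length r within depth >= n. In an
   ordering by depth, v strongly reaches only vertices of depth at most 1 less
   than its own, and weakly r-reaches only vertices of depth at most r less. *)

Require Import Defs.
From mathcomp Require Import all_boot zify.

(** * A sufficient condition for a minor *)

(** [P] and [Q] serve as branch sets of the two adjacent vertices, and any [t] singletons from [D]
    as those of the edgeless side. *)
Lemma minor_Kstar2 (t : nat) (G : sgraph) (P Q D : {set G}) :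
  connected_in P -> connected_in Q ->
  [disjoint P & Q] -> [disjoint P & D] -> [disjoint Q & D] ->
  (exists x y, [/\ x \in P, y \in Q & adj x y]) ->
  {in D, forall l, (exists2 x, x \in P & adj l x) /\
                   (exists2 y, y \in Q & adj l y)} ->
  t <= #|D| -> minor (Kstar 2 t) G.
Proof.
move=> cP cQ dPQ dPD dQD [x [y [xP yQ xy]]] HD leD.
pose l (j : 'I_t) : G := enum_val (widen_ord leD j).
have lD j : l j \in D by apply: enum_valP.
have l_inj : injective l.
  by move=> i j /enum_val_inj /(congr1 val) /= /val_inj.
have lP j : l j \notin P by rewrite (disjointFl dPD).
have lQ j : l j \notin Q by rewrite (disjointFl dQD).
pose B (h : Kstar 2 t) : {set G} :=
  match h with
  | inl i => if i == ord0 then P else Q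
  | inr j => [set l j]
  end.
have I2 (i j : 'I_2) : i != j -> (i == ord0) = ~~ (j == ord0).
  by case: i j => [[|[|?]] ?] [[|[|?]] ?].
exists B; split.
- move=> [i|j] /=; first by case: ifP => _; apply/set0Pn; [exists x|exists y].
  by apply/set0Pn; exists (l j); rewrite inE.
- move=> [i|j] /=; first by case: ifP.
  by move=> u w; rewrite !inE => /eqP -> /eqP ->; apply: connect0.
- move=> [i|i] [j|j] /=.
  + move=> ij; have {}ij : i != j by apply: contraNneq ij => ->.
    rewrite (I2 _ _ ij); case: (j == ord0) => //=.
    by rewrite disjoint_sym.
  + by move=> _; rewrite disjoint_sym disjoints1; case: ifP.
  + by move=> _; rewrite disjoints1; case: ifP.
  + by move=> ij; rewrite disjoints1 inE; apply: contraNneq ij => /l_inj ->.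
- move=> [i|i] [j|j] //=.
  + move=> /I2 ->; case: (j == ord0) => /=; last by exists x, y.
    by exists y, x; rewrite adj_sym.
  + have [[p pP lp] [q qQ lq]] := HD _ (lD j).
    by move=> _; case: ifP => _; [exists p|exists q]; exists (l j);
      rewrite inE adj_sym.
  + have [[p pP lp] [q qQ lq]] := HD _ (lD i).
    by move=> _; exists (l i); case: ifP => _; [exists p|exists q]; rewrite inE.
Qed.

(** * Connectivity and breadth-first search in induced subgraphs *)

Section Layering.
Variable G : sgraph.
Implicit Types (U R : {set G}).

Definition induced U : rel G := fun u w => [&& u \in U, w \in U & adj u w].

Lemma induced_sym U : connect_sym (induced U).
Proof.
by apply: sym_connect_sym => x y; rewrite /induced andbCA adj_sym.
Qed.

Lemma connect_induced U v p :
  v \in U -> path (@adj G) v p -> all [in U] p ->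
  connect (induced U) v (last v p).
Proof.
elim: p v => [|w p IH] v vU //= /andP[vw wp] /andP[wU pU].
apply: connect_trans (IH w wU wp pU).
by apply: connect1; rewrite /induced vU wU.
Qed.

(** Adjacency is symmetric, so the one-sided bound on [d] lets it change by at most one along an
    edge in either direction. *)
Lemma path_lipschitz U (d : G -> nat) v p :
  {in U &, forall u w, adj u w -> d w <= (d u).+1} ->
  v \in U -> path (@adj G) v p -> all [in U] p ->
  (d (last v p) <= d v + size p) && (d v <= d (last v p) + size p).
Proof.
move=> dstep; elim: p v => [|w p IH] v vU /=; first by rewrite !addn0 leqnn.
move=> /andP[vw wp] /andP[wU pU]; have := IH w wU wp pU.
have := dstep v w vU wU vw; rewrite adj_sym in vw.
have := dstep w v wU vU vw; lia.
Qed.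

Lemma connect_induced_in U v w :
  v \in U -> connect (induced U) v w -> w \in U.
Proof.
move=> vU vw; rewrite -(closed_connect (a := mem U) _ vw) // => x y.
by case/and3P => xU yU _; rewrite xU yU.
Qed.

Fixpoint ball U R n : {set G} :=
  if n is n'.+1 then
    ball U R n' :|: [set y in U | [exists z in ball U R n', adj z y]]
  else R.

Lemma path_ball U R z p :
  z \in R -> path (induced U) z p -> last z p \in ball U R (size p).
Proof.
move=> zR; elim/last_ind: p => [|p y IH] //.
rewrite rcons_path size_rcons last_rcons => /andP[/IH lp /and3P[_ yU ly]].
rewrite /= in_setU inE yU; apply/orP; right.
by apply/existsP; exists (last z p); rewrite lp.
Qed.

(** [d] is the distance to [R] in [G[U]] and [par] points one step closer. Roots are their own
    parents, so that iterating [par] is total and stabilises at a root. *)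
Lemma bfs U R :
  R \subset U ->
  {in U, forall x, exists2 z, z \in R & connect (induced U) z x} ->
  exists (d : G -> nat) (par : G -> G),
    [/\ {in R, forall x, d x = 0 /\ par x = x},
        {in U, forall x, x \notin R ->
           [/\ par x \in U, adj x (par x) & d x = (d (par x)).+1]}
      & {in U &, forall u w, adj u w -> d w <= (d u).+1}].
Proof.
move=> sRU conn.
have /fin_all_exists[d dP] (x : G) :
    exists n, x \in U -> x \in ball U R n /\ forall m, x \in ball U R m -> n <= m.
  case: (boolP (x \in U)) => [xU|_]; last by exists 0.
  have ex : exists n, x \in ball U R n.
    have [z zR /connectP[p zp ->]] := conn _ xU.
    by exists (size p); apply: path_ball.
  by case: (ex_minnP ex) => n xn min; exists n.
have d0 : {in R, forall x, d x = 0}.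
  move=> x xR; have [_ /(_ 0 xR)] := dP x (subsetP sRU _ xR).
  by rewrite leqn0 => /eqP.
have dstep : {in U &, forall u w, adj u w -> d w <= (d u).+1}.
  move=> u w uU wU uw; have [_ minw] := dP w wU; apply: minw.
  rewrite /= in_setU inE wU; apply/orP; right; apply/existsP; exists u.
  by rewrite uw; have [-> _] := dP u uU.
have /fin_all_exists[par parP] (x : G) : exists y,
    if x \in R then y = x else
    x \in U -> [/\ y \in U, adj x y & d x = (d y).+1].
  case xR: (x \in R); first by exists x.
  case: (boolP (x \in U)) => [xU|_]; last by exists x.
  have [] := dP x xU; case dx: (d x) => [|n] /=; first by rewrite xR.
  move=> xn min.
  (* By minimality [x] is not in [ball U R n], so it enters the next ball through a neighbour [z] in
     [ball U R n]; were [d z < n], [dstep] would give [d x <= n]. *)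
  move: xn; rewrite in_setU => /orP[/min|]; first by rewrite ltnn.
  rewrite inE xU => /existsP[z /andP[zn zx]].
  have zU : z \in U.
    elim: n zn {dx min} => [|n IH] /=; first exact: (subsetP sRU).
    by rewrite in_setU inE => /orP[/IH|/andP[]].
  exists z => _; split; rewrite 1?adj_sym //; congr _.+1.
  have [_ /(_ n zn) zn'] := dP z zU.
  by apply/eqP; rewrite eqn_leq zn' andbT -ltnS -dx dstep.
exists d, par; split=> // x.
  by move=> xR; have := parP x; rewrite xR d0.
by move=> xU xR; have := parP x; rewrite (negbTE xR) => /(_ xU).
Qed.

(** * One round of peeling *)

Definition frontier U : {set G} :=
  [set u in U | [exists w, (w \notin U) && adj u w]].

(* Every component of [G[U]] is attached to the rest of [G] through a single
   connected set. *)
Definition anchored U : Prop := forall v, v \in U -> exists Q : {set G},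
  [/\ connected_in Q, [disjoint Q & U]
    & {in frontier U, forall f, connect (induced U) v f ->
         exists2 q, q \in Q & adj f q}].

(** One root per component, taken in the frontier whenever the component meets it: in an anchored
    set such a root is adjacent to the anchor. *)
Lemma roots_exist U : exists R : {set G},
  [/\ R \subset U,
      {in U, forall x, exists2 z, z \in R & connect (induced U) z x},
      {in R &, forall x y, connect (induced U) x y -> x = y}
    & {in R & frontier U, forall z f, connect (induced U) z f -> z \in frontier U}].
Proof.
pose e := induced U; pose F := frontier U.
(* Both the picked frontier vertex and the default depend only on the component of [x]. *)
pose rho x := odflt (root e x) [pick f | (f \in F) && connect e x f].
have sym := induced_sym U.
have rhoC x : connect e x (rho x).
  rewrite /rho; case: pickP => [f /andP[]//|_] /=; exact: connect_root.
have rhoE x y : connect e x y -> rho x = rho y.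
  move=> xy; rewrite /rho (rootP sym xy); congr odflt; apply: eq_pick => f.
  by rewrite (same_connect sym xy).
have rhoF x f : f \in F -> connect e x f -> rho x \in F.
  move=> fF xf; rewrite /rho; case: pickP => [? /andP[]//|/(_ f)].
  by rewrite fF xf.
exists (rho @: U); split.
- by apply/subsetP => _ /imsetP[x xU ->]; apply: connect_induced_in (rhoC x).
- by move=> x xU; exists (rho x); [apply: imset_f | rewrite sym].
- move=> _ _ /imsetP[x xU ->] /imsetP[y yU ->] xy; apply: rhoE.
  by apply: connect_trans (rhoC x) (connect_trans xy _); rewrite sym.
- move=> _ f /imsetP[x xU ->] fF xf; apply: (rhoF _ f) => //.
  exact: connect_trans (rhoC x) xf.
Qed.

(** All components of [G[U]] are treated at once, by one BFS forest with a root in each. *)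
Lemma peel t U :
  2 <= t -> ~ minor (Kstar 2 t) G -> U != set0 -> anchored U ->
  exists H : {set G},
    [/\ H \subset U, H != set0, frontier U \subset H, anchored (U :\: H)
      & forall r v (X : {set G}), v \in U ->
          {in X, forall x, x \in H /\ exists p,
             [/\ path (@adj G) v p, all [in U] p, size p <= r & last v p = x]} ->
          #|X| <= (t - 1) * (2 * r + 1)].
Proof.
move=> t2 noM U0 anchU.
have [R [sRU Rconn Runiq RF]] := roots_exist U.
have [d [par [dR dU dstep]]] := bfs _ _ sRU Rconn.
set e := induced U in Rconn Runiq RF *; set F := frontier U in RF *.
have sym : connect_sym e := induced_sym U.
have sFU : F \subset U by apply/subsetP => x; rewrite inE => /andP[].
have parU x : x \in U -> par x \in U.
  move=> xU; case: (boolP (x \in R)) => xR; first by have [_ ->] := dR _ xR.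
  by have [] := dU x xU xR.
have parC x : x \in U -> connect e x (par x).
  move=> xU; case: (boolP (x \in R)) => xR; first by have [_ ->] := dR _ xR.
  have [pU ax _] := dU x xU xR; apply: connect1.
  by rewrite /e /induced xU pU ax.
have iterU i x : x \in U -> iter i par x \in U.
  by move=> xU; elim: i => //= i; apply: parU.
have iterC i x : x \in U -> connect e x (iter i par x).
  move=> xU; elim: i => [|i IH] /=; first exact: connect0.
  by apply: connect_trans IH _; apply: parC; apply: iterU.
have iterd i x : x \in U -> d (iter i par x) = d x - i.
  move=> xU; elim: i => [|i IH] /=; first by rewrite subn0.
  case: (boolP (iter i par x \in R)) => xR.
    by have [dx px] := dR _ xR; rewrite px IH; lia.
  by have [_ _] := dU _ (iterU i x xU) xR; rewrite IH; lia.
have d0R x : x \in U -> d x = 0 -> x \in R.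
  by move=> xU dx; apply: contraT => /(dU x xU)[_ _]; rewrite dx.
have iterE i j x : x \in U -> d (iter i par x) = d (iter j par x) ->
    iter i par x = iter j par x.
  (* below the root the depth determines the exponent; from the root on [par]
     is constant *)
  move=> xU; wlog ij : i j / i <= j.
    by move=> W; case: (leqP i j) => [/W//|/ltnW/W W' /esym/W' ->].
  rewrite !iterd // => dd.
  case: (ltnP (d x) j) => jd; last by (have -> : i = j by lia).
  have /d0R xiR: d (iter i par x) = 0 by rewrite iterd //; lia.
  rewrite -(subnK ij) iterD.
  by elim: (j - i) => //= k <-; have [] := dR _ (xiR (iterU _ _ xU)).
(* The roots are added because a component may have no frontier vertex, as when [U] is all of [G];
   thus [H] meets every component. *)
pose H := [set x | [exists f in F :|: R, fconnect par f x]].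
have HP x : reflect (exists f i, f \in F :|: R /\ x = iter i par f) (x \in H).
  rewrite inE; apply: (iffP existsP) => [[f /andP[fF fx]]|[f [i [fF ->]]]].
    by exists f, (findex par f x); rewrite iter_findex.
  by exists f; rewrite fF fconnect_iter.
clearbody H.
have sFRU : F :|: R \subset U by rewrite subUset sFU.
have sHU : H \subset U.
  by apply/subsetP => x /HP[f [i [/(subsetP sFRU) fU ->]]]; apply: iterU.
have sFRH : F :|: R \subset H.
  by apply/subsetP => x xF; apply/HP; exists x, 0.
have iterH i x : x \in H -> iter i par x \in H.
  by move=> /HP[f [j [fF ->]]]; apply/HP; exists f, (i + j); rewrite iterD.
have toR x : x \in U -> iter (d x) par x \in R.
  by move=> xU; apply: d0R; rewrite ?iterU // iterd // subnn.
exists H; split=> //.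
- case/set0Pn: U0 => x /Rconn[z zR _]; apply/set0Pn; exists z.
  by apply: (subsetP sFRH); rewrite inE zR orbT.
- by apply: subset_trans sFRH; apply: subsetUl.
- move=> v; rewrite inE => /andP[vH vU].
  (* The anchor is the part of [H] in the component of [v] in [G[U]]. It is connected since each of
     its vertices climbs within it to the same root. *)
  exists (H :&: [set x | connect e v x]); split.
  + have reach x : x \in H :&: [set x | connect e v x] ->
        connect (induced (H :&: [set x | connect e v x])) x (iter (d x) par x).
      rewrite !inE => /andP[xH vx].
      have xU := subsetP sHU _ xH.
      have inC i : iter i par x \in H :&: [set x | connect e v x].
        rewrite in_setI iterH // inE; exact: connect_trans (iterC _ _ xU).
      elim: {1}(d x) => [|i IH]; first exact: connect0.
      apply: connect_trans IH _ => /=.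
      case: (boolP (iter i par x \in R)) => xR.
        by have [_ ->] := dR _ xR; apply: connect0.
      apply: connect1; rewrite /induced inC (inC i.+1).
      by have [] := dU _ (iterU i x xU) xR.
    move=> x y xC yC; apply: connect_trans (reach x xC) _.
    have xU : x \in U by move: xC; rewrite inE => /andP[/(subsetP sHU)].
    have yU : y \in U by move: yC; rewrite inE => /andP[/(subsetP sHU)].
    have -> : iter (d x) par x = iter (d y) par y.
      apply: Runiq; rewrite ?toR // sym.
      apply: (@connect_trans _ _ y); first by rewrite sym iterC.
      apply: (@connect_trans _ _ x); last exact: iterC.
      move: xC yC; rewrite !inE => /andP[_ vx] /andP[_ vy].
      by apply: connect_trans vx; rewrite sym.
    rewrite [connect _ _ _]induced_sym; exact: reach.
  + rewrite disjoint_subset; apply/subsetP => x.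
    by rewrite !inE => /andP[-> _].
  + move=> f; rewrite inE => /andP[]; rewrite inE => /andP[fH fU].
    case/existsP=> w /andP[wUH fw] vf; exists w => //.
    (* If [w] were outside [U], then [f] would be a frontier vertex of [U], hence in [H]. *)
    have wU : w \in U.
      apply: contraNT fH => wU; apply: (subsetP sFRH).
      rewrite inE [f \in F]inE fU; apply/orP; left.
      by apply/existsP; exists w; rewrite wU.
    have wH : w \in H by move: wUH; rewrite inE wU andbT negbK.
    rewrite in_setI wH inE; apply: (@connect_trans _ _ f).
      apply: connect_sub vf => x y /and3P[].
      rewrite !inE => /andP[_ xU] /andP[_ yU] xy.
      by apply: connect1; rewrite /e /induced xU yU.
    by apply: connect1; rewrite /e /induced fU wU.
move=> r v X vU XP.
pose C := H :&: [set x | connect e v x].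
(* the leaves of the tree [C], except the root *)
pose D := [set x in C | (x \notin R) &&
                        [forall h in H, (par h == x) ==> (h == x)]].
have sCU x : x \in C -> x \in U by rewrite inE => /andP[/(subsetP sHU)].
have sDC x : x \in D -> x \in C by rewrite inE => /andP[].
have parCC x : x \in C -> par x \in C.
  rewrite !in_setI => /andP[xH]; rewrite !inE => vx.
  rewrite (iterH 1) //; apply: connect_trans vx _; apply: parC.
  exact: (subsetP sHU).
have parD x : x \in C -> par x \notin D.
  move=> xC; apply/negP; rewrite inE => /and3P[_ pR /forallP/(_ x)].
  have xH : x \in H by move: xC; rewrite inE => /andP[].
  rewrite xH eqxx /= => /eqP xp.
  have xR: x \notin R by rewrite xp.
  by have [_ _] := dU x (sCU x xC) xR; rewrite -xp => /n_Sn.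
(* Among the vertices of [C] with [x] as an ancestor, one of maximal depth is a leaf. *)
have leaf x : x \in C -> x \notin R -> exists2 l, l \in D & exists i, x = iter i par l.
  move=> xC xR.
  pose P h := (h \in C) && fconnect par h x.
  have Px : P x by rewrite /P xC connect0.
  case: (arg_maxnP d Px) => l /andP[lC lx] max.
  exists l; last by exists (findex par l x); rewrite iter_findex.
  have lR : l \notin R.
    apply: contra xR => lR; rewrite -(iter_findex lx).
    by elim: (findex _ _ _) => //= i IH; have [_ ->] := dR _ IH.
  rewrite inE lC lR; apply/forallP => h; apply/implyP => hH; apply/implyP => /eqP hl.
  apply: contraT => hl'.
  have hU := subsetP sHU _ hH.
  have hC : h \in C.
    rewrite in_setI hH inE; apply: (@connect_trans _ _ l).
      by move: lC; rewrite in_setI inE => /andP[].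
    by rewrite sym -hl; apply: parC.
  have hR : h \notin R.
    by apply: contra hl' => hR; rewrite -hl; have [_ ->] := dR _ hR.
  have Ph : P h.
    rewrite /P hC; apply: connect_trans lx; rewrite -hl; exact: (fconnect_iter par 1).
  by have [_ _] := dU h hU hR; rewrite hl => dh;
    have hl_le : d h <= d l := max h Ph; rewrite dh ltnn in hl_le.
have DF l : l \in D -> l \in F.
  rewrite inE => /and3P[lC lR /forallP lH].
  have /HP[f [[|i] [fF lf]]] : l \in H by move: lC; rewrite inE => /andP[].
    by move: fF; rewrite /= in lf; rewrite -lf inE (negbTE lR) orbF.
  have := lH (iter i par f); rewrite (iterH _ _ (subsetP sFRH _ fF)) lf eqxx /=.
  move=> /eqP il; move: lR; rewrite lf /=.
  have [iR|nR] := boolP (iter i par f \in R).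
    by have [_ ->] := dR _ iR; rewrite iR.
  have fU := subsetP sFRU _ fF.
  by have [_ _] := dU _ (iterU i f fU) nR; rewrite -il => /n_Sn.
have cardD : #|D| <= t - 1.
  rewrite leqNgt; apply/negP => ltD; apply: noM.
  have tD : t <= #|D| by move: ltD; clear; lia.
  have [l lD] : exists l, l \in D.
    by apply/card_gt0P; apply: leq_trans tD; apply: ltnW.
  have [Q [cQ dQ QF]] := anchU v vU.
  have vD x : x \in C -> connect e v x by rewrite in_setI inE => /andP[].
  set z := iter (d l) par l.
  have lU := sCU _ (sDC _ lD).
  have zR : z \in R by apply: toR.
  have toz x : x \in C -> iter (d x) par x = z.
    move=> xC; have xU := sCU x xC; apply: Runiq; rewrite ?toR //.
    apply: (@connect_trans _ _ x); first by rewrite sym iterC.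
    apply: (@connect_trans _ _ l); last exact: iterC.
    by apply: connect_trans (vD l (sDC _ lD)); rewrite sym vD.
  have iterCC i x : x \in C -> iter i par x \in C.
    by move=> xC; elim: i => //= i; apply: parCC.
  have zC : z \in C by apply: iterCC; apply: sDC.
  have zF : z \in F.
    by apply: RF zR (DF _ lD) _; rewrite sym; apply: iterC.
  have zD : z \notin D by rewrite inE zR andbF.
  have [q qQ zq] := QF _ zF (vD z zC).
  (* The branch sets are [Q], [C :\: D] and the leaves. Parents are never leaves, so climbing to the
     root [z] stays in [C :\: D]; each leaf sees its parent there, and sees [Q] as a frontier
     vertex. *)
  apply: (@minor_Kstar2 t G Q (C :\: D) D) => //.
  + have reach x : x \in C :\: D -> connect (induced (C :\: D)) x z.
      rewrite inE => /andP[xD xC]; rewrite -(toz x xC).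
      have inY i : iter i par x \in C :\: D.
        rewrite in_setD iterCC // andbT.
        by case: i => // i; rewrite iterS parD // iterCC.
      elim: {1}(d x) => [|i IH]; first exact: connect0.
      apply: connect_trans IH _ => /=.
      case: (boolP (iter i par x \in R)) => xR.
        by have [_ ->] := dR _ xR; apply: connect0.
      apply: connect1; rewrite /induced inY (inY i.+1).
      by have [] := dU _ (iterU i x (sCU x xC)) xR.
    move=> x y xY yY; apply: connect_trans (reach x xY) _.
    rewrite [connect _ _ _]induced_sym; exact: reach.
  + apply: disjointWr dQ; apply/subsetP => x; rewrite inE => /andP[_]; exact: sCU.
  + by apply: disjointWr dQ; apply/subsetP => x /sDC; exact: sCU.
  + by rewrite disjoint_subset; apply/subsetP => x; rewrite !inE => /andP[].
  + by exists q, z; rewrite inE zD zC adj_sym.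
  + move=> x xD; have xC := sDC x xD; split.
      by apply: QF; [apply: DF | apply: vD].
    exists (par x); first by rewrite inE parD // parCC.
    have xR : x \notin R by move: xD; rewrite inE => /and3P[].
    by have [] := dU x (sCU x xC) xR.
have XC x : x \in X -> [/\ x \in C, d x <= d v + r & d v <= d x + r].
  move=> /XP[xH [p [vp pU pr xE]]].
  have /andP[x1 x2] := path_lipschitz U d v p dstep vU vp pU.
  rewrite xE in x1 x2; split.
  - by rewrite in_setI xH inE -xE; apply: connect_induced.
  - by apply: leq_trans x1 _; rewrite leq_add2l.
  - by apply: leq_trans x2 _; rewrite leq_add2l.
have CR x y : x \in C -> y \in C -> y \in R -> exists i, y = iter i par x.
  move=> xC yC yR; exists (d x); have xU := sCU x xC.
  apply: Runiq => //; first exact: toR.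
  apply: (@connect_trans _ _ x); last exact: iterC.
  move: xC yC; rewrite !in_setI !inE => /andP[_ vx] /andP[_ vy].
  by apply: connect_trans vx; rewrite sym.
(* Without leaves the tree is its root alone, so [X] has at most one vertex; [2 <= t] makes the
   bound positive. *)
case: (set_0Vmem D) => [D0|[l0 l0D]].
  apply: (@leq_trans 1); last by rewrite muln_gt0 subn_gt0 t2 addn1.
  apply/card_le1_eqP => x y xX yX.
  have R1 z : z \in X -> z \in C /\ z \in R.
    move=> /XC[zC _ _]; split=> //; apply: contraT => /(leaf z zC)[l].
    by rewrite D0 inE.
  have [xC xR] := R1 x xX; have [yC yR] := R1 y yX.
  apply: Runiq => //; move: xC yC; rewrite !in_setI !inE => /andP[_ vx] /andP[_ vy].
  by apply: connect_trans vx; rewrite sym.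
have leafX x : x \in C -> exists2 l, l \in D & exists i, x = iter i par l.
  move=> xC; case: (boolP (x \in R)) => xR; last exact: leaf.
  by exists l0 => //; apply: CR => //; apply: sDC.
(* [g (l, k)] is the ancestor of the leaf [l] at depth [d v + k - r]. As [d x] is within [r] of
   [d v], the index [k = d x + r - d v] is in range and gives depth [d x], which determines [x] on
   the path from [l]. *)
pose g (u : G * 'I_(2 * r + 1)) := iter (d u.1 - (d v + u.2 - r)) par u.1.
apply: (@leq_trans #|g @: setX D setT|); last first.
  apply: leq_trans (leq_imset_card _ _) _.
  by rewrite cardsX cardsT card_ord leq_mul2r cardD orbT.
apply: subset_leq_card; apply/subsetP => x /XC[xC x1 x2].
have [l lD [i xE]] := leafX x xC.
have lU := sCU l (sDC l lD).
have k_lt : d x + r - d v < 2 * r + 1 by move: x1 x2; clear; lia.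
apply/imsetP; exists (l, Ordinal k_lt); first by rewrite in_setX lD inE.
rewrite /g /= {1}xE; apply: iterE => //; rewrite -xE iterd //.
by move: x1 x2 (iterd i l lU); rewrite -xE; clear; lia.
Qed.

(** * Iterating the rounds *)

(** Induction on [#|U|]: depth 0 on the [H] of [peel], and the depths of [U :\: H] shifted by one.
    The frontier clause carries the induction: a vertex of [U :\: H] adjacent to [H] is in the
    frontier of [U :\: H], so it gets depth 1. *)
Lemma layering t U :
  2 <= t -> ~ minor (Kstar 2 t) G -> anchored U ->
  exists d : G -> nat,
    [/\ {in frontier U, forall x, d x = 0},
        {in U &, forall u w, adj u w -> d u <= (d w).+1}
      & forall r v n (X : {set G}), v \in U -> n <= d v ->
          {in X, forall x, d x = n /\ exists p,
             [/\ path (@adj G) v p, all [pred y | (y \in U) && (n <= d y)] p,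
                 size p <= r & last v p = x]} ->
          #|X| <= (t - 1) * (2 * r + 1)].
Proof.
move=> t2 noM; have [m] := ubnP #|U|; elim: m U => // m IH U ltU anchU.
have [U0|U0] := eqVneq U set0.
  by exists (fun=> 0); split=> // r v n X; rewrite U0 inE.
have [H [sHU H0 sFH anchH XH]] := peel t U t2 noM U0 anchU.
have [|d [dF dstep dX]] := IH (U :\: H) _ anchH.
  rewrite -ltnS; apply: leq_trans ltU; rewrite ltnS cardsD (setIidPr sHU).
  have := subset_leq_card sHU; have : 0 < #|H| by rewrite card_gt0.
  lia.
have UH x : x \in U -> x \notin H -> x \in U :\: H by rewrite inE => -> ->.
exists (fun x => if x \in H then 0 else (d x).+1); split.
- by move=> x /(subsetP sFH) ->.
- move=> u w uU wU uw /=; case: ifP => // /negbT uH; case: ifP => wH.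
    by rewrite dF // inE UH //; apply/existsP; exists w; rewrite uw inE wH.
  by rewrite ltnS; apply: dstep => //; apply: UH; rewrite ?wH.
(* For [n = 0] the vertices of [X] lie in [H] and [peel] applies; for positive [n] the paths avoid
   [H] and the induction hypothesis applies. *)
- move=> r v [|n] X vU vn XP.
    apply: (XH r v) => // x /XP[dx [p [vp pU pr xE]]]; split.
      by move: dx; case: ifP.
    by exists p; split=> //; apply: sub_all pU => y /andP[].
  have vH : v \notin H by apply/negP => vH; rewrite vH in vn.
  rewrite (negbTE vH) ltnS in vn.
  apply: (dX r v n) => //; first exact: UH.
  move=> x /XP[dx [p [vp pU pr xE]]]; split.
    by move: dx; case: ifP => // _ [].
  exists p; split=> //; apply: sub_all pU => y /= /andP[yU].
  by case: ifP => // /negbT yH; rewrite ltnS => ->; rewrite UH.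
Qed.

(** * Ordering by depth and counting by levels *)

Definition depth_order (d : G -> nat) : {set G * G} :=
  [set u | (d u.1 < d u.2) ||
           (d u.1 == d u.2) && (enum_rank u.1 <= enum_rank u.2)].

Lemma depth_order_linear d : linear_order (rel_of (depth_order d)).
Proof.
apply/linear_orderP; split=> [x y|y x z|x y]; rewrite /rel_of !inE /=.
- move=> H; apply/enum_rank_inj/val_inj => /=; lia.
- lia.
- lia.
Qed.

Lemma depth_orderW d x y : rel_of (depth_order d) x y -> d x <= d y.
Proof. rewrite /rel_of inE /=; lia. Qed.

Lemma card_levels (d : G -> nat) c m n (X : {set G}) :
  {in X, forall x, d x <= n <= d x + m} ->
  (forall j, j <= n -> #|[set x in X | d x == j]| <= c) ->
  #|X| <= m.+1 * c.
Proof.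
(* [Y j] is the level of depth [n - j]; the additive form makes it empty for [j > n]. *)
move=> dX le_c; pose Y (j : 'I_m.+1) := [set x in X | d x + j == n].
have sXY : X \subset \bigcup_j Y j.
  apply/subsetP => x xX; have /andP[x1 x2] := dX x xX.
  have j_lt : n - d x < m.+1 by lia.
  by apply/bigcupP; exists (Ordinal j_lt); rewrite // inE xX /= subnKC.
apply: leq_trans (subset_leq_card sXY) _.
apply: (@leq_trans (\sum_(j < m.+1) #|Y j|)).
  rewrite big_mkcond [X in _ <= X]big_mkcond /=.
  elim/big_ind2: _ => [|A a B b leA leB|//]; first by rewrite cards0.
  by apply: leq_trans (leq_card_setU _ _) (leq_add leA leB).
rewrite -[m.+1 in leqRHS]card_ord -sum_nat_const; apply: leq_sum => j _.
case: (leqP j n) => jn.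
  apply: leq_trans (le_c (n - j) (leq_subr _ _)).
  by apply: subset_leq_card; apply/subsetP => x; rewrite !inE => /andP[->]; lia.
rewrite (_ : Y j = set0) ?cards0 //; apply/setP => x; rewrite !inE.
by apply/negP => /andP[_]; lia.
Qed.

End Layering.

(** * The bounds on the colouring numbers *)

(** For [t = 1] both bounds would be 0, which fails already for the one-vertex graph; hence
    [2 <= t]. *)
Theorem theorem24 (t : nat) (ht : 2 <= t) (G : sgraph)
    (hG : ~ minor (Kstar 2 t) G) (r : nat) (hr : 1 <= r) :
  scol G r <= 2 * (t - 1) * (2 * r + 1) /\
  wcol G r <= (t - 1) * (r + 1) * (2 * r + 1).
Proof.
(* The whole vertex set has empty frontier, so the empty anchor suffices. *)
have anchT : @anchored G setT.
  move=> v _; exists set0; split.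
  - by move=> x y; rewrite inE.
  - by rewrite disjoint_subset; apply/subsetP => x; rewrite inE.
  - by move=> f; rewrite !inE => /existsP[w]; rewrite inE.
have [d [_ dstep dX]] := layering G t setT ht hG anchT.
have {}dstep u w : adj u w -> d u <= (d w).+1 by apply: dstep; rewrite inE.
set le := rel_of (depth_order G d).
have leW x y : le x y -> d x <= d y by apply: depth_orderW.
have strictW v s : all (strict le v) s -> all (fun y => d v <= d y) s.
  by apply: sub_all => y /andP[_ /leW].
(* Strong reachability uses this with [m = 1], weak reachability with [m = r]. *)
have level (v : G) (X : {set G}) m :
    {in X, forall x, [/\ d x <= d v, d v <= d x + m & exists p,
       [/\ path (@adj G) v p, all (fun y => d x <= d y) p,
           size p <= r & last v p = x]]} ->
    #|X| <= m.+1 * ((t - 1) * (2 * r + 1)).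
  move=> XP; apply: (@card_levels G d _ m (d v)) => [x /XP[-> -> _] //|j jv].
  apply: (dX r v j) => // x.
  rewrite inE => /andP[/XP[_ _ [p [vp pd pr xE]]] /eqP dx].
  split=> //; exists p; split=> //; apply: sub_all pd => y /=.
  by rewrite inE dx.
split.
  rewrite /scol; case: ex_minnP => k _; apply; apply/existsP.
  exists (depth_order G d); rewrite depth_order_linear; apply/forallP => v.
  rewrite -mulnA; apply: (level v) => x; rewrite inE -/le => /andP[/leW xv].
  case/existsP=> p /and4P[vp _ /eqP xE]; have pr := size_bseq p.
  case/lastP: {p}(val p) vp xE pr => [|q y] /=.
    by move=> _ <- _ _; split; [exact: leqnn|exact: leq_addr|exists nil].
  rewrite last_rcons size_rcons /inner belast_rcons /= => vp yx qr /strictW qd.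
  have qy := vp; rewrite rcons_path in qy; case/andP: qy => _ /dstep qy.
  (* The vertex before [x] is [v] or an inner vertex, so its depth is at least [d v], and the last
     edge loses at most one. *)
  have vx : d v <= d x + 1.
    rewrite addn1 -yx; apply: leq_trans qy.
    by have := mem_last v q; rewrite inE => /predU1P[->//|/(allP qd)].
  split=> //; exists (rcons q y); rewrite size_rcons last_rcons; split=> //.
  rewrite all_rcons yx leqnn /=; apply: sub_all qd => z; exact: leq_trans.
rewrite /wcol; case: ex_minnP => k _; apply; apply/existsP.
exists (depth_order G d); rewrite depth_order_linear; apply/forallP => v.
rewrite [(t - 1) * _]mulnC -mulnA addn1; apply: (level v) => x.
rewrite inE -/le => /andP[/leW xv].
case/existsP=> p /and4P[vp _ /eqP xE]; have pr := size_bseq p.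
move=> pd.
have {}pd : all (fun y => d x <= d y) p.
  case/lastP: {p}(val p) xE pd {vp pr} => [|q y] //.
  rewrite last_rcons /inner belast_rcons all_rcons => -> /strictW ->.
  by rewrite leqnn.
split=> //; last by exists p.
(* Inner vertices are now only known to be at least as deep as [x]; the length of the path alone
   bounds the drop in depth by [r]. *)
have lip : {in setT &, forall u w : G, adj u w -> d w <= (d u).+1}.
  by move=> u w _ _; rewrite adj_sym => /dstep.
have pT : all [in [set: G]] p by apply/allP => u; rewrite inE.
have /andP[_ vx] := path_lipschitz G setT d v p lip (in_setT v) vp pT.
by rewrite xE in vx; apply: leq_trans vx _; rewrite leq_add2l.
Qed.
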